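(* Let $n>3$ be an odd number, let $h=\frac{n-1}{2}$, and let $T\in\mathcal{BC}^{0,1}(V_n)$. Then for $p,s\in\rho_{\mathcal F}(T)$ with $s\notin[p]$ the following equation holds: $$\begin{aligned} &\mathcal F_n^R(s,T)S_L^{-1}(p,T)+S_R^{-1}(s,T)\mathcal F_n^L(p,T)\\ &\quad+\gamma_n\Big[\sum_{i=0}^{h-2}\mathcal Q_s^{h-i-1}(T)S_R^{-1}(s,T)S_L^{-1}(p,T)\mathcal Q_p^{i+1}(T)+\sum_{i=0}^{h-1}\mathcal Q_s^{h-i}(T)\mathcal Q_p^{i+1}(T)\Big]\\ &=\big\{[\mathcal F_n^R(s,T)-\mathcal F_n^L(p,T)]p-\overline s[\mathcal F_n^R(s,T)-\mathcal F_n^L(p,T)]\big\}(p^2-2s_0p+|s|^2)^{-1}. \end{aligned}$$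
   Context: $\mathbb R_n$ is the real Clifford algebra generated by $e_1,\dots,e_n$ with $e_\ell^2=-1$ and $e_\ell e_m+e_me_\ell=0$ for $\ell\neq m$. A point of $\mathbb R^{n+1}$ is identified with the paravector $x=x_0+\underline x$, $\underline x=\sum_{j=1}^n x_je_j$; $\overline x=x_0-\underline x$, $|x|^2=\sum_{j=0}^nx_j^2$. $\mathbb S$ is the set of $\underline x$ with $|\underline x|=1$ and $[x]=\{x_0+J|\underline x|:J\in\mathbb S\}$. $V$ is a real Banach space, $V_n=V\otimes\mathbb R_n$ is the associated two-sided Banach module over $\mathbb R_n$, and $\mathcal B(V_n)$ is the space of bounded right linear operators on $V_n$. Clifford numbers act on operators by $(aT)(v)=a\,T(v)$, $(Ta)(v)=T(av)$; products of operators are compositions. $\mathcal{BC}^{0,1}(V_n)$ is the set of paravector operators $T=T_0+\sum_{\ell=1}^n e_\ell T_\ell$ with pairwise commuting components $T_\ell\in\mathcal B(V)$ (acting componentwise on $V_n$). Put $\overline T=T_0-\sum_{\ell=1}^n e_\ell T_\ell$, so that $T+\overline T=2T_0$ and $T\overline T=\sum_{\ell=0}^nT_\ell^2$. $\rho_{\mathcal F}(T)$ is the set of $s\in\mathbb R^{n+1}$ such that $s^2\mathcal I-s(T+\overline T)+T\overline T$ is invertible in $\mathcal B(V_n)$. For $s\in\rho_{\mathcal F}(T)$: $\mathcal Q_s(T)=(s^2\mathcal I-s(T+\overline T)+T\overline T)^{-1}$, $\mathcal Q_s^k(T)=(\mathcal Q_s(T))^k$, $S_L^{-1}(s,T)=(s\mathcal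 I-\overline T)\mathcal Q_s(T)$, $S_R^{-1}(s,T)=\mathcal Q_s(T)(s\mathcal I-\overline T)$, $\mathcal F_n^L(s,T)=\gamma_n(s\mathcal I-\overline T)\mathcal Q_s(T)^{\frac{n+1}2}$, $\mathcal F_n^R(s,T)=\gamma_n\mathcal Q_s(T)^{\frac{n+1}2}(s\mathcal I-\overline T)$, where $\gamma_n=(-1)^{\frac{n-1}2}2^{n-1}\big[\big(\frac{n-1}2\big)!\big]^2$. *)

(* Defs.v *)
From HB Require Import structures.
From mathcomp Require Import boolp reals normedtype.
From mathcomp Require Import all_boot all_order all_algebra.
From mathcomp Require Import ring.
Import Order.TTheory GRing.Theory Num.Theory.
Import numFieldNormedType.Exports.

Set Implicit Arguments.
Unset Strict Implicit.
Unset Printing Implicit Defensive.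

Local Open Scope ring_scope.

(* The basis of the Clifford algebra R_n is (e_A), A ranging over the subsets *)
(* of 'I_n, with e_A = e_{l_1} ... e_{l_k} for A = {l_1 < ... < l_k}.  The    *)
(* generators e_1, ..., e_n are indexed from 0, i.e. by 'I_n.  Then           *)
(*   e_A e_B = (-1)^#{(i, j) in A x B | j <= i} e_{A symdiff B},              *)
(* a pair j < i for each transposition, a pair j = i for each e_i ^ 2 = -1.   *)
Section CliffordProduct.
Variables (R : realType) (n : nat).

Definition symdiff (A B : {set 'I_n}) : {set 'I_n} := (A :\: B) :|: (B :\: A).

Definition csign (A B : {set 'I_n}) : R :=
  \prod_(i in A) \prod_(j in B | (j <= i)%N) (-1).

(* The product (x (x) e_A) (y (x) e_B) = csign A B (op x y) (x) e_{A symdiff B}, *)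
(* extended by linearity; with op the product of R, or a scaling, it gives    *)
(* the product of R_n and its two actions on V (x) R_n.                       *)
Definition cprod (U W X : lmodType R) (op : U -> W -> X)
    (a : {ffun {set 'I_n} -> U}) (b : {ffun {set 'I_n} -> W}) :
    {ffun {set 'I_n} -> X} :=
  [ffun C => \sum_A \sum_(B | symdiff A B == C) csign A B *: op (a A) (b B)].

Definition delta1 (U : lmodType R) (A : {set 'I_n}) (x : U) :
  {ffun {set 'I_n} -> U} := [ffun B => if B == A then x else 0].

Lemma in_symdiff A B i : (i \in symdiff A B) = (i \in A) (+) (i \in B).
Proof. by rewrite !inE; case: (i \in A); case: (i \in B). Qed.

Lemma symdiffA : associative symdiff.
Proof. by move=> A B C; apply/setP => i; rewrite !in_symdiff addbA. Qed.

Lemma symdiff0s A : symdiff set0 A = A.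
Proof. by apply/setP => i; rewrite in_symdiff inE. Qed.

Lemma symdiffs0 A : symdiff A set0 = A.
Proof. by apply/setP => i; rewrite in_symdiff inE addbF. Qed.

Lemma symdiffss A : symdiff A A = set0.
Proof. by apply/setP => i; rewrite in_symdiff inE addbb. Qed.

Lemma csignE A B :
  csign A B = \prod_i \prod_j
     (if [&& i \in A, j \in B & (j <= i)%N] then -1 else 1).
Proof.
rewrite /csign big_mkcond; apply: eq_bigr => i _.
case: ifP => _ /=; last by rewrite big1_eq.
by rewrite big_mkcond; apply: eq_bigr.
Qed.

Lemma csignDl A B C : csign (symdiff A B) C = csign A C * csign B C.
Proof.
rewrite !csignE -big_split; apply: eq_bigr => i _ /=.
rewrite -big_split; apply: eq_bigr => j _ /=.
rewrite in_symdiff.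
by case: (i \in A); case: (i \in B); case: (j \in C); case: (j <= i)%N;
  rewrite /= ?mulrNN ?mulr1 ?mul1r.
Qed.

Lemma csignDr A B C : csign A (symdiff B C) = csign A B * csign A C.
Proof.
rewrite !csignE -big_split; apply: eq_bigr => i _ /=.
rewrite -big_split; apply: eq_bigr => j _ /=.
rewrite in_symdiff.
by case: (i \in A); case: (j \in B); case: (j \in C); case: (j <= i)%N;
  rewrite /= ?mulrNN ?mulr1 ?mul1r.
Qed.

Lemma csign0s A : csign set0 A = 1.
Proof. by rewrite /csign big_set0. Qed.

Lemma csigns0 A : csign A set0 = 1.
Proof. by rewrite csignE big1 // => i _; rewrite big1 // => j _; rewrite inE andbF. Qed.

Lemma norm_csign A B : `|csign A B| = 1.
Proof.
by rewrite /csign normr_prod big1 // => i _; rewrite normr_prod big1 // => j _;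
  rewrite normrN1.
Qed.

Lemma csign1 i j : csign [set i] [set j] = if (j <= i)%N then -1 else 1.
Proof. by rewrite /csign big_set1 big_mkcondr big_set1. Qed.

Lemma csign1N i j : i != j -> csign [set j] [set i] = - csign [set i] [set j].
Proof.
by move=> ij; rewrite !csign1; move: ij; rewrite -val_eqE /=;
  case: ltngtP => //= _ _; rewrite opprK.
Qed.

Definition bilin (U W X : lmodType R) (op : U -> W -> X) : Prop :=
  [/\ forall x y z, op (x + y) z = op x z + op y z,
      forall x y z, op x (y + z) = op x y + op x z,
      forall k x y, op (k *: x) y = k *: op x y &
      forall k x y, op x (k *: y) = k *: op x y].

Lemma delta1_sum (U : lmodType R) (a : {ffun {set 'I_n} -> U}) :
  a = \sum_A delta1 A (a A).
Proof.
apply/ffunP => B; rewrite sum_ffunE (bigD1 B) //= ffunE eqxx big1 ?addr0 //.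
by move=> A nA; rewrite ffunE eq_sym (negPf nA).
Qed.

Section Theory.
Variables (U W X : lmodType R) (op : U -> W -> X).
Hypothesis op_bilin : bilin op.

Let opDl x y z : op (x + y) z = op x z + op y z. Proof. by case: op_bilin. Qed.
Let opDr x y z : op x (y + z) = op x y + op x z. Proof. by case: op_bilin. Qed.
Let opZl k x y : op (k *: x) y = k *: op x y. Proof. by case: op_bilin. Qed.
Let opZr k x y : op x (k *: y) = k *: op x y. Proof. by case: op_bilin. Qed.

Lemma cprodDl a b c : cprod op (a + b) c = cprod op a c + cprod op b c.
Proof.
apply/ffunP => C; rewrite !ffunE -big_split; apply: eq_bigr => A _ /=.
by rewrite -big_split; apply: eq_bigr => B _ /=; rewrite ffunE opDl scalerDr.
Qed.

Lemma cprodDr a b c : cprod op a (b + c) = cprod op a b + cprod op a c.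
Proof.
apply/ffunP => C; rewrite !ffunE -big_split; apply: eq_bigr => A _ /=.
by rewrite -big_split; apply: eq_bigr => B _ /=; rewrite ffunE opDr scalerDr.
Qed.

Lemma cprodZl k a b : cprod op (k *: a) b = k *: cprod op a b.
Proof.
apply/ffunP => C; rewrite !ffunE scaler_sumr; apply: eq_bigr => A _ /=.
rewrite scaler_sumr; apply: eq_bigr => B _ /=.
by rewrite ffunE opZl !scalerA mulrC.
Qed.

Lemma cprodZr k a b : cprod op a (k *: b) = k *: cprod op a b.
Proof.
apply/ffunP => C; rewrite !ffunE scaler_sumr; apply: eq_bigr => A _ /=.
rewrite scaler_sumr; apply: eq_bigr => B _ /=.
by rewrite ffunE opZr !scalerA mulrC.
Qed.

Lemma op_suml I (r : seq I) (P : pred I) F y :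
  op (\sum_(i <- r | P i) F i) y = \sum_(i <- r | P i) op (F i) y.
Proof.
apply: (big_morph (fun x => op x y)) => [x z|]; first exact: opDl.
by rewrite -(scale0r 0) opZl scale0r.
Qed.

Lemma op_sumr I (r : seq I) (P : pred I) F x :
  op x (\sum_(i <- r | P i) F i) = \sum_(i <- r | P i) op x (F i).
Proof.
apply: (big_morph (op x)) => [y z|]; first exact: opDr.
by rewrite -(scale0r 0) opZr scale0r.
Qed.

Lemma op0l y : op 0 y = 0. Proof. by rewrite -(scale0r 0) opZl scale0r. Qed.
Lemma op0r x : op x 0 = 0. Proof. by rewrite -(scale0r 0) opZr scale0r. Qed.

Lemma cprod_delta A B x y :
  cprod op (delta1 A x) (delta1 B y) =
    delta1 (symdiff A B) (csign A B *: op x y).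
Proof.
apply/ffunP => C; rewrite !ffunE (bigD1 A) //= [X in _ + X]big1 ?addr0; last first.
  move=> A' nA; rewrite big1 // => B' _.
  by rewrite ffunE (negPf nA) op0l scaler0.
rewrite ffunE eqxx big_mkcond (bigD1 B) //= [X in _ + X]big1 ?addr0; last first.
  by move=> B' nB; rewrite ffunE (negPf nB) op0r scaler0 if_same.
by rewrite ffunE eqxx eq_sym.
Qed.

Lemma cprod_delta1l x (b : {ffun {set 'I_n} -> W}) :
  cprod op (delta1 set0 x) b = [ffun A => op x (b A)].
Proof.
apply/ffunP => C; rewrite !ffunE (bigD1 set0) //= [X in _ + X]big1 ?addr0; last first.
  move=> A' nA; rewrite big1 // => B' _.
  by rewrite ffunE (negPf nA) op0l scaler0.
rewrite (big_pred1 C) => [|B /=]; last by rewrite symdiff0s.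
by rewrite ffunE eqxx csign0s scale1r.
Qed.

Lemma cprod_delta1r (a : {ffun {set 'I_n} -> U}) y :
  cprod op a (delta1 set0 y) = [ffun A => op (a A) y].
Proof.
apply/ffunP => C; rewrite !ffunE (bigD1 C) //= [X in _ + X]big1 ?addr0; last first.
  move=> A' nA; rewrite big1 // => B' /eqP e.
  rewrite ffunE; case: eqP => [B0|_]; last by rewrite op0r scaler0.
  by move: nA; rewrite -e B0 symdiffs0 eqxx.
rewrite big_mkcond (bigD1 set0) //= [X in _ + X]big1 ?addr0; last first.
  by move=> B' nB; rewrite ffunE (negPf nB) op0r scaler0 if_same.
by rewrite symdiffs0 eqxx ffunE eqxx csigns0 scale1r.
Qed.

Lemma cprod_bilin : bilin (cprod op).
Proof.
by split; [exact: cprodDl | exact: cprodDr | exact: cprodZl | exact: cprodZr].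
Qed.

End Theory.

Lemma cprodA (U1 U2 U3 U12 U23 X : lmodType R)
    (op1 : U1 -> U23 -> X) (op2 : U2 -> U3 -> U23)
    (op3 : U12 -> U3 -> X) (op4 : U1 -> U2 -> U12) a b c :
  bilin op1 -> bilin op2 -> bilin op3 -> bilin op4 ->
  (forall x y z, op1 x (op2 y z) = op3 (op4 x y) z) ->
  cprod op1 a (cprod op2 b c) = cprod op3 (cprod op4 a b) c.
Proof.
move=> b1 b2 b3 b4 E.
have c1 := cprod_bilin b1; have c2 := cprod_bilin b2.
have c3 := cprod_bilin b3; have c4 := cprod_bilin b4.
rewrite (delta1_sum a) (delta1_sum b) (delta1_sum c).
rewrite (op_suml c4) (op_suml c3) (op_suml c1); apply: eq_bigr => A _.
rewrite (op_suml c2) (op_sumr c1) (op_sumr c4) (op_suml c3).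
apply: eq_bigr => B _.
rewrite (op_sumr c2) (op_sumr c1) (op_sumr c3); apply: eq_bigr => C _.
rewrite !cprod_delta // symdiffA csignDl csignDr.
case: b1 => _ _ _ ->; case: b3 => _ _ -> _.
by rewrite E !scalerA; congr (delta1 _ (_ *: _)); ring.
Qed.

End CliffordProduct.

Section CliffordAlgebra.
Variables (R : realType) (n : nat).

(* An alias, to hide the pointwise product of {ffun _ -> R}. *)
Definition cliff : Type := {ffun {set 'I_n} -> R^o}.

HB.instance Definition _ := GRing.Lmodule.on cliff.

Definition clmul (a b : cliff) : cliff := cprod (fun x y : R^o => x * y) a b.
Definition cl_one : cliff := delta1 set0 (1 : R^o).

Lemma bilin_mul : bilin (fun x y : R^o => x * y).
Proof.
split=> *; [exact: mulrDl | exact: mulrDr | |].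
  by rewrite /GRing.scale /= mulrA.
by rewrite /GRing.scale /= mulrCA.
Qed.

Lemma clmulA : associative clmul.
Proof. by move=> a b c; apply: cprodA => *; rewrite ?mulrA //; exact: bilin_mul. Qed.

Lemma clmul1l : left_id cl_one clmul.
Proof.
move=> a; rewrite /clmul (cprod_delta1l bilin_mul).
by apply/ffunP => A; rewrite ffunE mul1r.
Qed.

Lemma clmul1r : right_id cl_one clmul.
Proof.
move=> a; rewrite /clmul (cprod_delta1r bilin_mul).
by apply/ffunP => A; rewrite ffunE mulr1.
Qed.

Lemma clmulDl : left_distributive clmul +%R.
Proof. by move=> a b c; apply: cprodDl; exact: bilin_mul. Qed.

Lemma clmulDr : right_distributive clmul +%R.
Proof. by move=> a b c; apply: cprodDr; exact: bilin_mul. Qed.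

Lemma cl_one_neq0 : cl_one != 0.
Proof. by apply/eqP => /ffunP/(_ set0)/eqP; rewrite !ffunE eqxx oner_eq0. Qed.

HB.instance Definition _ := GRing.Zmodule_isNzRing.Build cliff
  clmulA clmul1l clmul1r clmulDl clmulDr cl_one_neq0.

Lemma clscaleAl k (a b : cliff) : k *: (a * b) = (k *: a) * b.
Proof. by symmetry; apply: cprodZl; exact: bilin_mul. Qed.

Lemma clscaleAr k (a b : cliff) : k *: (a * b) = a * (k *: b).
Proof. by symmetry; apply: cprodZr; exact: bilin_mul. Qed.

HB.instance Definition _ := GRing.Lmodule_isLalgebra.Build R cliff clscaleAl.
HB.instance Definition _ := GRing.Lalgebra_isAlgebra.Build R cliff clscaleAr.

Definition clgen (l : 'I_n) : cliff := delta1 [set l] (1 : R^o).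

Lemma clgen_mul i j : clgen i * clgen j =
  delta1 (symdiff [set i] [set j]) (csign R [set i] [set j] : R^o).
Proof.
rewrite /GRing.mul /= /clmul (cprod_delta bilin_mul).
by rewrite /GRing.scale /= !mulr1.
Qed.

Lemma clgen_sqr l : clgen l ^+ 2 = -1.
Proof.
rewrite expr2 clgen_mul symdiffss csign1 leqnn.
by apply/ffunP => A; rewrite !ffunE; case: eqP; rewrite ?oppr0.
Qed.

Lemma clgen_anticomm l m : l != m -> clgen l * clgen m + clgen m * clgen l = 0.
Proof.
move=> lm; rewrite !clgen_mul (csign1N R lm).
rewrite [symdiff [set m] _]/symdiff setUC -/(symdiff _ _).
by apply/ffunP => A; rewrite !ffunE; case: eqP; rewrite ?addr0 ?subrr.
Qed.

End CliffordAlgebra.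

Section Paravectors.
Variables (R : realType) (n : nat).
Implicit Types x y : 'rV[R]_n.+1.

Definition parav x : cliff R n :=
  (x 0 0)%:A + \sum_(l < n) x 0 (lift ord0 l) *: clgen R l.

Definition pconj x : 'rV[R]_n.+1 :=
  \row_j (if j == 0 then x 0 j else - x 0 j).

Definition pvec x : 'rV[R]_n.+1 := \row_j (if j == 0 then 0 else x 0 j).

(* The Euclidean norm; the norm `|x| of the library is the sup norm. *)
Definition pnorm x : R := Num.sqrt (\sum_j x 0 j ^+ 2).

Definition unit_sphere (J : 'rV[R]_n.+1) : Prop := J 0 0 = 0 /\ pnorm J = 1.

Definition pclass x y : Prop :=
  exists2 J, unit_sphere J &
    y = x 0 0 *: delta_mx 0 0 + pnorm (pvec x) *: J.

End Paravectors.

Section TwoSidedModule.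
Variables (R : realType) (n : nat) (V : normedModType R).

(* V (x) R_n, as the families (v_A) standing for the sums of v_A (x) e_A. *)
Definition cmod : Type := {ffun {set 'I_n} -> V}.

HB.instance Definition _ := GRing.Lmodule.on cmod.

Definition lact (a : cliff R n) (v : cmod) : cmod :=
  cprod (fun (x : R^o) (u : V) => x *: u) a v.

Definition ract (v : cmod) (a : cliff R n) : cmod :=
  cprod (fun (u : V) (x : R^o) => x *: u) v a.

Lemma bilin_scale : bilin (fun (x : R^o) (u : V) => x *: u).
Proof.
split=> *; [exact: scalerDl | exact: scalerDr | |].
  by rewrite scalerA.
by rewrite !scalerA mulrC.
Qed.

Lemma bilin_scaler : bilin (fun (u : V) (x : R^o) => x *: u).
Proof.
split=> *; [exact: scalerDr | exact: scalerDl | |].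
  by rewrite !scalerA mulrC.
by rewrite scalerA.
Qed.

Lemma lactDl a b v : lact (a + b) v = lact a v + lact b v.
Proof. by apply: cprodDl; exact: bilin_scale. Qed.

Lemma lactDr a u v : lact a (u + v) = lact a u + lact a v.
Proof. by apply: cprodDr; exact: bilin_scale. Qed.

Lemma lactA a b v : lact a (lact b v) = lact (a * b) v.
Proof.
by apply: cprodA => *; rewrite ?scalerA //; [exact: bilin_scale ..| exact: bilin_mul].
Qed.

Lemma lact1 v : lact 1 v = v.
Proof.
rewrite /lact (cprod_delta1l bilin_scale).
by apply/ffunP => A; rewrite ffunE scale1r.
Qed.

Lemma ractDl u v a : ract (u + v) a = ract u a + ract v a.
Proof. by apply: cprodDl; exact: bilin_scaler. Qed.

Lemma ractDr v a b : ract v (a + b) = ract v a + ract v b.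
Proof. by apply: cprodDr; exact: bilin_scaler. Qed.

Lemma ractZl k v a : ract (k *: v) a = k *: ract v a.
Proof. by apply: cprodZl; exact: bilin_scaler. Qed.

Lemma ractZr k v a : ract v (k *: a) = k *: ract v a.
Proof. by apply: cprodZr; exact: bilin_scaler. Qed.

Lemma ractA v a b : ract (ract v a) b = ract v (a * b).
Proof.
symmetry; apply: cprodA => *; rewrite ?scalerA ?[_ * x]mulrC //.
- exact: bilin_scaler.
- exact: bilin_mul.
- exact: bilin_scaler.
- exact: bilin_scaler.
- by rewrite mulrC.
Qed.

Lemma ract1 v : ract v 1 = v.
Proof.
rewrite /ract (cprod_delta1r bilin_scaler).
by apply/ffunP => A; rewrite ffunE scale1r.
Qed.

Lemma lract a v b : lact a (ract v b) = ract (lact a v) b.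
Proof.
apply: cprodA => *; [exact: bilin_scale | exact: bilin_scaler
  | exact: bilin_scaler | exact: bilin_scale |].
by rewrite !scalerA mulrC.
Qed.

Definition cmod_norm (v : cmod) : R := \sum_A `|v A|.

Lemma cmod_normD u v : cmod_norm (u + v) <= cmod_norm u + cmod_norm v.
Proof.
by rewrite /cmod_norm -big_split ler_sum // => A _; rewrite ffunE ler_normD.
Qed.

Lemma cmod_norm_eq0 v : cmod_norm v = 0 -> v = 0.
Proof.
move=> /eqP; rewrite psumr_eq0 => [/allP v0|A _]; last exact: normr_ge0.
apply/ffunP => A; rewrite ffunE; apply/eqP; rewrite -normr_eq0.
exact: (v0 A (mem_index_enum A)).
Qed.

Lemma cmod_normMn v k : cmod_norm (v *+ k) = cmod_norm v *+ k.
Proof.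
rewrite /cmod_norm -sumrMnl; apply: eq_bigr => A _.
by rewrite ffunMnE normrMn.
Qed.

Lemma cmod_normN v : cmod_norm (- v) = cmod_norm v.
Proof. by apply: eq_bigr => A _; rewrite ffunE normrN. Qed.

HB.instance Definition _ := Num.Zmodule_isNormed.Build R cmod
  cmod_normD cmod_norm_eq0 cmod_normMn cmod_normN.

Lemma cmod_normE (v : cmod) : `|v| = \sum_A `|v A|.
Proof. by []. Qed.

End TwoSidedModule.

Definition bounded_op (R : realType) (U : normedZmodType R) (f : U -> U) : Prop :=
  exists M : R, forall v, `|f v| <= M * `|v|.

Section BoundedOperators.
Variables (R : realType) (n : nat) (V : normedModType R).
Local Notation Vn := (cmod n V).

Record bop := BOp {
  bop_fun :> Vn -> Vn;
  bopD : forall u v, bop_fun (u + v) = bop_fun u + bop_fun v;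
  bop_ract : forall v a, bop_fun (ract v a) = ract (bop_fun v) a;
  bop_bounded : bounded_op bop_fun }.

Lemma bopP (f g : bop) : (forall v, f v = g v) -> f = g.
Proof.
case: f g => [f f1 f2 f3] [g g1 g2 g3] /= /funext E; subst g.
by congr BOp; exact: Prop_irrelevance.
Qed.

HB.instance Definition _ := gen_eqMixin bop.
HB.instance Definition _ := gen_choiceMixin bop.

Lemma bopZ (f : bop) k v : f (k *: v) = k *: f v.
Proof.
by rewrite -[v in LHS]ract1 -ractZr bop_ract ractZr ract1.
Qed.

#[local] Obligation Tactic := idtac.

Program Definition bop0 : bop := @BOp (fun=> 0) _ _ _.
Next Obligation. by move=> u v /=; rewrite addr0. Qed.
Next Obligation. by move=> v a /=; rewrite -(scale0r (0 : Vn)) ractZl !scale0r. Qed.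
Next Obligation. by exists 0 => v /=; rewrite normr0 mul0r. Qed.

Program Definition bop_opp (f : bop) : bop := @BOp (fun v => - f v) _ _ _.
Next Obligation. by move=> f u v /=; rewrite bopD opprD. Qed.
Next Obligation. by move=> f v a /=; rewrite bop_ract -[- f v]scaleN1r ractZl scaleN1r. Qed.
Next Obligation.
by move=> f; have [M fM] := bop_bounded f; exists M => v /=; rewrite normrN.
Qed.

Program Definition bop_add (f g : bop) : bop := @BOp (fun v => f v + g v) _ _ _.
Next Obligation. by move=> f g u v /=; rewrite !bopD addrACA. Qed.
Next Obligation. by move=> f g v a /=; rewrite !bop_ract ractDl. Qed.
Next Obligation.
move=> f g; have [M fM] := bop_bounded f; have [N gN] := bop_bounded g.
by exists (M + N) => v /=; rewrite (le_trans (ler_normD _ _)) // mulrDl lerD.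
Qed.

Program Definition bop_one : bop := @BOp id _ _ _.
Next Obligation. by []. Qed.
Next Obligation. by []. Qed.
Next Obligation. by exists 1 => v /=; rewrite mul1r. Qed.

Program Definition bop_mul (f g : bop) : bop := @BOp (fun v => f (g v)) _ _ _.
Next Obligation. by move=> f g u v /=; rewrite !bopD. Qed.
Next Obligation. by move=> f g v a /=; rewrite !bop_ract. Qed.
Next Obligation.
move=> f g; have [M fM] := bop_bounded f; have [N gN] := bop_bounded g.
exists (`|M| * N) => v /=; rewrite (le_trans (fM _)) // -mulrA.
by rewrite (le_trans (ler_wpM2r _ (ler_norm M))) // ler_wpM2l.
Qed.

Program Definition bop_scale (k : R) (f : bop) : bop := @BOp (fun v => k *: f v) _ _ _.
Next Obligation. by move=> k f u v /=; rewrite bopD scalerDr. Qed.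
Next Obligation. by move=> k f v a /=; rewrite bop_ract ractZl. Qed.
Next Obligation.
move=> k f; have [M fM] := bop_bounded f; exists (`|k| * M) => v /=.
rewrite cmod_normE -mulrA (eq_bigr (fun A => `|k| * `|f v A|)) => [|A _].
  by rewrite -mulr_sumr; apply: ler_wpM2l => //; exact: fM.
by rewrite ffunE normrZ.
Qed.

Lemma bop_addA : associative bop_add.
Proof. by move=> f g h; apply: bopP => v /=; rewrite addrA. Qed.
Lemma bop_addC : commutative bop_add.
Proof. by move=> f g; apply: bopP => v /=; rewrite addrC. Qed.
Lemma bop_add0 : left_id bop0 bop_add.
Proof. by move=> f; apply: bopP => v /=; rewrite add0r. Qed.
Lemma bop_addN : left_inverse bop0 bop_opp bop_add.
Proof. by move=> f; apply: bopP => v /=; rewrite addNr. Qed.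

HB.instance Definition _ :=
  GRing.isZmodule.Build bop bop_addA bop_addC bop_add0 bop_addN.

Lemma bop_mulA : associative bop_mul.
Proof. by move=> f g h; apply: bopP. Qed.
Lemma bop_mul1l : left_id bop_one bop_mul.
Proof. by move=> f; apply: bopP. Qed.
Lemma bop_mul1r : right_id bop_one bop_mul.
Proof. by move=> f; apply: bopP. Qed.
Lemma bop_mulDl : left_distributive bop_mul +%R.
Proof. by move=> f g h; apply: bopP. Qed.
Lemma bop_mulDr : right_distributive bop_mul +%R.
Proof. by move=> f g h; apply: bopP => v /=; rewrite bopD. Qed.

(* Only a pzRingType: 1 = 0 if V is the zero space. *)
HB.instance Definition _ := GRing.Zmodule_isPzRing.Build bop
  bop_mulA bop_mul1l bop_mul1r bop_mulDl bop_mulDr.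

Lemma bop_scaleA a b f : bop_scale a (bop_scale b f) = bop_scale (a * b) f.
Proof. by apply: bopP => v /=; rewrite scalerA. Qed.
Lemma bop_scale1 : left_id 1 bop_scale.
Proof. by move=> f; apply: bopP => v /=; rewrite scale1r. Qed.
Lemma bop_scaleDr : right_distributive bop_scale +%R.
Proof. by move=> k f g; apply: bopP => v /=; rewrite scalerDr. Qed.
Lemma bop_scaleDl f : {morph bop_scale^~ f : a b / a + b}.
Proof. by move=> a b; apply: bopP => v /=; rewrite scalerDl. Qed.

HB.instance Definition _ := GRing.Zmodule_isLmodule.Build R bop
  bop_scaleA bop_scale1 bop_scaleDr bop_scaleDl.

Lemma lact_bounded (a : cliff R n) : bounded_op (lact a : Vn -> Vn).
Proof.
exists (\sum_A `|a A|) => v; rewrite !cmod_normE big_distrlr /=.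
pose G A B := `|a A| * `|v B|.
suff: \sum_C `|lact a v C| <= \sum_C \sum_A \sum_(B | symdiff A B == C) G A B.
  move=> /le_trans; apply; rewrite exchange_big /=; apply: ler_sum => A _.
  by rewrite [leRHS](partition_big (symdiff A) xpredT).
apply: ler_sum => C _; rewrite /lact ffunE (le_trans (ler_norm_sum _ _ _)) //.
apply: ler_sum => A _; rewrite (le_trans (ler_norm_sum _ _ _)) //.
by apply: ler_sum => B _; rewrite !normrZ norm_csign mul1r.
Qed.

(* The operator a I: since (a T)(v) = a T(v) and (T a)(v) = T(a v), the      *)
(* operators a T and T a are clop a * T and T * clop a.                      *)
Definition clop (a : cliff R n) : bop :=
  BOp (lactDr a) (fun v b => lract a v b) (lact_bounded a).

Section Lift.
Variables (f : {linear V -> V}) (fb : bounded_op f).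

Definition lift_fun (v : Vn) : Vn := [ffun A => f (v A)].

Lemma lift_funD u v : lift_fun (u + v) = lift_fun u + lift_fun v.
Proof. by apply/ffunP => A; rewrite !ffunE linearD. Qed.

Lemma lift_fun_ract v a : lift_fun (ract v a) = ract (lift_fun v) a.
Proof.
apply/ffunP => C; rewrite !ffunE linear_sum; apply: eq_bigr => A _.
by rewrite linear_sum; apply: eq_bigr => B _; rewrite !linearZ /= !(ffunE, scalerA) mulrC.
Qed.

Lemma lift_fun_bounded : bounded_op lift_fun.
Proof.
have [M fM] := fb; exists M => v; rewrite !cmod_normE mulr_sumr.
by apply: ler_sum => A _; rewrite ffunE.
Qed.

Definition lift_op : bop := BOp lift_funD lift_fun_ract lift_fun_bounded.

End Lift.

End BoundedOperators.

(* In a paravector operator the components are determined by the operator:    *)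
(* T (v (x) 1) is the sum of the T_l(v) (x) e_l.                              *)
Record bc01 (R : realType) (n : nat) (V : normedModType R) := BC01 {
  bc_comp : 'I_n.+1 -> {linear V -> V};
  bc_bounded : forall l, bounded_op (bc_comp l);
  bc_comm : forall l m v,
    bc_comp l (bc_comp m v) = bc_comp m (bc_comp l v) }.

Definition invertible (A : pzRingType) (x : A) : Prop :=
  exists y, y * x = 1 /\ x * y = 1.

(* The two-sided inverse, and 0 by convention if there is none. *)
Definition inverse (A : pzRingType) (x : A) : A :=
  if pselect (invertible x) is left h then projT1 (cid h) else 0.

Lemma inverseP (A : pzRingType) (x : A) :
  invertible x -> inverse x * x = 1 /\ x * inverse x = 1.
Proof. by rewrite /inverse; case: pselect => // h _; case: cid. Qed.

Lemma inverse_unique (A : pzRingType) (x y : A) :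
  y * x = 1 -> x * y = 1 -> inverse x = y.
Proof.
move=> yx xy; have [_ xi] : _ /\ _ := inverseP (ex_intro _ y (conj yx xy)).
by rewrite -[inverse x]mul1r -yx -mulrA xi mulr1.
Qed.

Definition parop (R : realType) (n : nat) (V : normedModType R)
  (s : 'rV[R]_n.+1) : bop n V := clop V (parav s).

Definition gamma (R : realType) (n : nat) : R :=
  (-1) ^+ (n.-1)./2 * 2 ^+ n.-1 * (((n.-1)./2)`!%:R) ^+ 2.

Section FResolvents.
Variables (R : realType) (n : nat) (V : normedModType R) (T : bc01 n V).
Implicit Types s : 'rV[R]_n.+1.

Definition bc_lift (l : 'I_n.+1) : bop n V := lift_op n (bc_bounded T l).

Definition bc_vec : bop n V :=
  \sum_(l < n) clop V (clgen R l) * bc_lift (lift ord0 l).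

Definition bc_op : bop n V := bc_lift ord0 + bc_vec.
Definition bc_bar : bop n V := bc_lift ord0 - bc_vec.

Definition Qpoly s : bop n V :=
  clop V (parav s ^+ 2) - parop V s * (bc_op + bc_bar) + bc_op * bc_bar.

Definition rhoF s : Prop := invertible (Qpoly s).

Definition Qs s : bop n V := inverse (Qpoly s).

Definition SL s : bop n V := (parop V s - bc_bar) * Qs s.
Definition SR s : bop n V := Qs s * (parop V s - bc_bar).

Definition FL s : bop n V := gamma R n *: ((parop V s - bc_bar) * Qs s ^+ (n.+1)./2).
Definition FR s : bop n V := gamma R n *: (Qs s ^+ (n.+1)./2 * (parop V s - bc_bar)).

End FResolvents.

(* Main.v *)
Require Import Defs.
From mathcomp Require Import boolp reals normedtype.
From mathcomp Require Import all_boot all_order all_algebra.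
From mathcomp Require Import ring lra zify.

(** Write S and P for the operators of multiplication by s and p, and D for the
    Sylvester operator D(x) = x P - S x.  If a right resolvent X at s and a left
    resolvent Y at p satisfy S X - X T = 1 and Y P - T Y = 1, then the middle
    terms X T Y cancel in D(X Y), so that D(X Y) = X - Y.  The noncommutative
    partial fraction expansion of the F-resolvents rests on this identity.

    With h = (n - 1) / 2, U = Q_s(T), W = Q_p(T), the left-hand side of the
    theorem is gamma_n L, where
      L = \sum_(0 <= j <= h) U^(h-j) X Y W^j + \sum_(0 <= i < h) U^(h-i) W^(i+1):
    the two products of an F-resolvent and an S-resolvent are the terms j = 0
    and j = h of the first sum.  Because S commutes with U and P with W, D passes
    through the outer powers.  Each term of the first sum then contributes
    U^(h-j) (X - Y) W^j, and each term of the second U^(h-i) (P - S) W^(i+1).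
    As X = U (S - a) and Y = (P - a) W, where a is the conjugate of T, the first
    sum telescopes except for the terms U^(h-i) (S - P) W^(i+1), which the second
    sum removes; hence gamma_n D(L) is the difference of the F-resolvents
    ([sylvester_Fresolvent]).

    It remains to invert D.  The operator x |-> x P - S' x, for S' the
    multiplication by the conjugate of s, composed with D, is the right
    multiplication by P^2 - 2 s_0 P + |s|^2, because S + S' and S' S are real
    scalars, hence central ([sylvester_pair]).  The Clifford number
    p^2 - 2 s_0 p + |s|^2 is a paravector, since p^2 = 2 p_0 p - |p|^2, and it
    vanishes only if s lies in the class of p; a nonzero paravector is
    invertible ([invertible_class_poly]).

    The commutation of S with Q_s(T), and the two resolvent equations, rest on
    T + conj T and T conj T having no Clifford part: the former is 2 T_0, and in
    the latter the cross terms e_l e_m T_l T_m cancel in pairs, by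
    anticommutation of the e_l and commutation of the T_l. *)

Set Implicit Arguments.
Unset Strict Implicit.
Unset Printing Implicit Defensive.

Import Order.TTheory GRing.Theory Num.Theory.

Local Open Scope ring_scope.

(** * Anticommuting families and inverses *)

(** Used both for the vector part of a paravector and for that of a paravector
    operator. The induction avoids a division by 2, unavailable in a general
    ring. *)
Lemma sqr_sum_anticomm (A : pzRingType) (I : eqType) (r : seq I) (w : I -> A) :
  uniq r -> (forall i j, i != j -> w i * w j + w j * w i = 0) ->
  (\sum_(i <- r) w i) ^+ 2 = \sum_(i <- r) w i ^+ 2.
Proof.
move=> + ac; elim: r => [|i r IHr] /=; first by rewrite !big_nil expr0n.
case/andP=> ir /IHr {}IHr; rewrite !big_cons -IHr !expr2 mulrDl !mulrDr.
suff cross : w i * (\sum_(j <- r) w j) + (\sum_(j <- r) w j) * w i = 0.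
  by rewrite addrA -[X in X + _]addrA cross addr0.
rewrite mulr_sumr mulr_suml -big_split big_seq big1 // => j jr /=.
by apply: ac; apply: contraNneq ir => ->.
Qed.

Lemma commr_inverse (A : pzRingType) (x y : A) :
  invertible x -> GRing.comm y x -> GRing.comm y (inverse x).
Proof.
move=> /inverseP[ix xi] yx; rewrite /GRing.comm.
rewrite -[LHS]mul1r -ix -!mulrA [x * (y * _)]mulrA -yx.
by rewrite -[y * x * _]mulrA xi mulr1.
Qed.

(** * The Sylvester operator of a pair of elements *)

Section Sylvester.
Variables (A : pzRingType) (S P : A).

Definition sylvester (x : A) : A := x * P - S * x.

Lemma sylvesterD x y : sylvester (x + y) = sylvester x + sylvester y.
Proof. by rewrite /sylvester mulrDl mulrDr opprD addrACA. Qed.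

Lemma sylvester_sum I (r : seq I) (F : I -> A) :
  sylvester (\sum_(i <- r) F i) = \sum_(i <- r) sylvester (F i).
Proof.
apply: (big_morph sylvester sylvesterD).
by rewrite /sylvester mul0r mulr0 subr0.
Qed.

Lemma sylvester_mul_comm u x v : GRing.comm S u -> GRing.comm P v ->
  sylvester (u * x * v) = u * sylvester x * v.
Proof.
move=> Su Pv; rewrite /sylvester mulrBr mulrBl !mulrA Su.
by rewrite -!mulrA Pv.
Qed.

(** The S-resolvent equation in its abstract form: both products X Y P and S X Y
    produce the term X T Y. *)
Lemma sylvester_resolvents T X Y : S * X - X * T = 1 -> Y * P - T * Y = 1 ->
  sylvester (X * Y) = X - Y.
Proof.
move=> /(canRL (subrK _)) SX /(canRL (subrK _)) YP.
rewrite /sylvester -mulrA YP mulrA SX mulrDr mulrDl mulr1 mul1r mulrA.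
by rewrite opprD addrACA subrr addr0.
Qed.

(** The two Sylvester operators, for S and for Sb, compose to a right
    multiplication by the polynomial (z - S) (z - Sb) evaluated at z = P; this is
    what turns an equation for [sylvester x] into a formula for x. *)
Lemma sylvester_pair Sb x : GRing.comm (S + Sb) x -> GRing.comm (Sb * S) x ->
  sylvester x * P - Sb * sylvester x = x * (P ^+ 2 - (S + Sb) * P + Sb * S).
Proof.
move=> cx dx; rewrite [RHS]mulrDr [x * (_ - _)]mulrBr -dx.
rewrite [x * (_ * P)]mulrA -cx expr2.
by rewrite /sylvester mulrBl mulrBr !mulrDl opprB opprD !mulrA !addrA addrAC.
Qed.

(** The F-resolvent equation before inversion of the Sylvester operator: the
    terms U^(h-j) (X - Y) W^j telescope up to U^(h-i) (S - P) W^(i+1), and the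
    second sum is the correction that compensates these. *)
Lemma sylvester_Fresolvent a T U W h :
    GRing.comm S U -> GRing.comm P W ->
    let X := U * (S - a) in let Y := (P - a) * W in
    S * X - X * T = 1 -> Y * P - T * Y = 1 ->
  sylvester (\sum_(0 <= j < h.+1) U ^+ (h - j) * (X * Y) * W ^+ j
         + \sum_(0 <= i < h) U ^+ (h - i) * W ^+ i.+1)
  = U ^+ h * X - Y * W ^+ h.
Proof.
move=> SU PW X Y SX YP.
have sylvester_powers m k x :
    sylvester (U ^+ m * x * W ^+ k) = U ^+ m * sylvester x * W ^+ k.
  by apply: sylvester_mul_comm; exact: commrX.
rewrite sylvesterD !sylvester_sum.
under eq_bigr do rewrite sylvester_powers (sylvester_resolvents SX YP) mulrBr mulrBl.
under [X in _ + X]eq_bigr do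
  rewrite -[U ^+ (h - _)]mulr1 sylvester_powers {1}/sylvester mul1r mulr1.
(* The two boundary terms are those of the right-hand side: j = 0 of the U X sum
   and j = h of the Y W sum. *)
rewrite sumrB big_nat_recl // big_nat_recr //= subn0 subnn !expr0 mulr1 mul1r.
rewrite [X in _ - X + _]addrC opprD addrACA -sumrB -[LHS]addrA -big_split /=.
rewrite big_nat big1 ?addr0 //= => i ih.
(* Shifting one factor U and one factor W brings the three terms to the common
   form U^(h-i) (_) W^(i+1), with middle factors of sum 0. *)
rewrite -[(h - i)%N]prednK ?subn_gt0 // -subnS [U ^+ _.+1]exprSr [W ^+ _.+1]exprS.
rewrite /X /Y !mulrA.
rewrite -!mulrBl -!mulrDl -!mulrBr -!mulrDr.
by rewrite opprB [_ - a + _]addrA subrK -[P - S]opprB subrr mulr0 !mul0r.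
Qed.

End Sylvester.

(** * Paravectors in the Clifford algebra *)

Section CliffordParavectors.
Variables (R : realType) (n : nat).
Implicit Types x p s : 'rV[R]_n.+1.

Let vecpart x : cliff R n := \sum_(l < n) x 0 (lift ord0 l) *: clgen R l.

Lemma vecpart_sqr x : vecpart x ^+ 2 = - (\sum_(l < n) x 0 (lift ord0 l) ^+ 2)%:A.
Proof.
rewrite /vecpart sqr_sum_anticomm ?index_enum_uniq //.
  rewrite scaler_suml -sumrN; apply: eq_bigr => l _.
  by rewrite exprZn clgen_sqr scalerN.
move=> i j ij; rewrite -!scalerAl -!scalerAr !scalerA mulrC -scalerDr.
by rewrite clgen_anticomm ?scaler0.
Qed.

Lemma parav_pconj x :
  parav (pconj x) = (x 0 0)%:A - vecpart x.
Proof.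
rewrite /parav mxE eqxx; congr (_ + _); rewrite -sumrN.
by apply: eq_bigr => l _; rewrite mxE /= scaleNr.
Qed.

Lemma paravD_pconj x : parav x + parav (pconj x) = (2 * x 0 0)%:A.
Proof.
rewrite parav_pconj /parav addrACA subrr addr0 -scalerDl.
by congr (_ *: _); ring.
Qed.

Lemma pnorm_sqr x : pnorm x ^+ 2 = x 0 0 ^+ 2 + \sum_(l < n) x 0 (lift ord0 l) ^+ 2.
Proof.
rewrite sqr_sqrtr ?big_ord_recl //.
by rewrite addr_ge0 ?sqr_ge0 // sumr_ge0 // => i _; exact: sqr_ge0.
Qed.

Lemma pconjK x : pconj (pconj x) = x.
Proof. by apply/rowP => j; rewrite !mxE; case: (j == 0); rewrite ?opprK. Qed.

Lemma pnorm_pconj x : pnorm (pconj x) = pnorm x.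
Proof.
congr Num.sqrt; apply: eq_bigr => j _.
by rewrite mxE; case: (j == 0); rewrite ?sqrrN.
Qed.

Lemma parav_mul_pconj x : parav x * parav (pconj x) = (pnorm x ^+ 2)%:A.
Proof.
rewrite parav_pconj /parav -/(vecpart x) mulrDl !mulrBr !mulr_algl !mulr_algr.
rewrite addrA subrK -expr2 vecpart_sqr opprK scalerA -scalerDl.
by rewrite pnorm_sqr expr2.
Qed.

(** A paravector is a root of the real polynomial
    (z - x) (z - conj x) = z^2 - 2 x_0 z + |x|^2. *)
Lemma parav_sqr x : parav x ^+ 2 = (2 * x 0 0) *: parav x - (pnorm x ^+ 2)%:A.
Proof.
by rewrite -mulr_algr -paravD_pconj mulrDr parav_mul_pconj addrK expr2.
Qed.

Lemma invertible_parav x : pnorm x ^+ 2 != 0 -> invertible (parav x).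
Proof.
move=> x0; exists ((pnorm x ^+ 2)^-1 *: parav (pconj x)).
rewrite -scalerAl -scalerAr parav_mul_pconj.
have := parav_mul_pconj (pconj x); rewrite pconjK pnorm_pconj => ->.
by rewrite scalerA mulVf // scale1r.
Qed.

Lemma paravD x y : parav (x + y) = parav x + parav y.
Proof.
rewrite /parav addrACA -big_split /= mxE -scalerDl; congr (_ + _).
by apply: eq_bigr => l _; rewrite mxE scalerDl.
Qed.

Lemma paravZ k x : parav (k *: x) = k *: parav x.
Proof.
rewrite /parav scalerDr scaler_sumr mxE scalerA; congr (_ + _).
by apply: eq_bigr => l _; rewrite mxE scalerA.
Qed.

Lemma parav_real (k : R) : parav (k *: delta_mx 0 0 : 'rV_n.+1) = k%:A.
Proof.
rewrite /parav !mxE eqxx mulr1 big1 ?addr0 // => l _.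
by rewrite !mxE mulr0 scale0r.
Qed.

(** Two paravectors with equal real parts and vector parts of equal length are in
    the same class. If the vector parts vanish, every unit vector is a witness,
    and there is one because n > 0; otherwise the vector part of s is
    normalized. *)
Lemma pclass_eq p s : (0 < n)%N -> s 0 0 = p 0 0 ->
  \sum_(l < n) s 0 (lift ord0 l) ^+ 2 = \sum_(l < n) p 0 (lift ord0 l) ^+ 2 ->
  pclass p s.
Proof.
move=> n0 sp0 spv.
have vecE (y : 'rV[R]_n.+1) :
    pnorm (pvec y) ^+ 2 = \sum_(l < n) y 0 (lift ord0 l) ^+ 2.
  rewrite pnorm_sqr mxE eqxx expr0n add0r.
  by apply: eq_bigr => l _; rewrite mxE.
set r := pnorm (pvec p).
have r_ge0 : 0 <= r by exact: sqrtr_ge0.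
have [r0|r0] := eqVneq r 0.
  exists (delta_mx 0 (lift ord0 (Ordinal n0))).
    split; first by rewrite mxE.
    apply/eqP; rewrite -(eqrXn2 (n := 2)) ?sqrtr_ge0 //.
    rewrite pnorm_sqr !mxE /= expr0n add0r (bigD1 (Ordinal n0)) //= big1 => [|l nl].
      by rewrite mxE !eqxx addr0.
    by rewrite mxE (inj_eq lift_inj) (negPf nl) expr0n.
  rewrite -/r r0 scale0r addr0; apply/rowP => j; rewrite !mxE eqxx /=.
  have [l ->|->] := unliftP ord0 j; last by rewrite eqxx mulr1.
  rewrite mulr0; apply/eqP; rewrite -sqrf_eq0.
  move: spv; rewrite -(vecE p) -/r r0 expr0n => /eqP.
  rewrite psumr_eq0 => [/allP/(_ l (mem_index_enum _))//|i _].
  exact: sqr_ge0.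
exists (r^-1 *: pvec s).
  split; first by rewrite !mxE eqxx mulr0.
  apply/eqP; rewrite -(eqrXn2 (n := 2)) ?sqrtr_ge0 //.
  rewrite pnorm_sqr !mxE eqxx mulr0 expr0n add0r.
  under eq_bigr do rewrite !mxE /= exprMn.
  by rewrite -mulr_sumr spv -(vecE p) -/r -exprMn mulVf.
rewrite scalerA mulfV // scale1r; apply/rowP => j; rewrite !mxE eqxx /= -sp0.
by case: eqP => [->|_]; rewrite ?mulr1 ?mulr0 ?addr0 ?add0r.
Qed.

(** Reducing p^2 by its own quadratic equation leaves the paravector
    al p + be, which is invertible unless it is 0. If al = 0, then p and s have
    the same real part, and be = 0 makes their norms equal; if al is not 0, then
    p is real, and the real part of al p + be is (p_0 - s_0)^2 plus the squared
    length of the vector part of s. Both cases put s in the class of p. *)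
Lemma invertible_class_poly p s : (0 < n)%N -> ~ pclass p s ->
  invertible (parav p ^+ 2 - (2 * s 0 0) *: parav p + (pnorm s ^+ 2)%:A).
Proof.
move=> n0 sp.
set al := 2 * (p 0 0 - s 0 0).
set be := pnorm s ^+ 2 - pnorm p ^+ 2.
have -> : parav p ^+ 2 - (2 * s 0 0) *: parav p + (pnorm s ^+ 2)%:A
        = parav (al *: p + be *: delta_mx 0 0).
  rewrite paravD paravZ parav_real parav_sqr [X in X + _]addrAC -scalerBl -mulrBr.
  by rewrite -addrA [X in _ + X]addrC -scalerBl.
apply: invertible_parav; rewrite pnorm_sqr.
set v := \sum_(l < n) _.
have vE : v = al ^+ 2 * \sum_(l < n) p 0 (lift ord0 l) ^+ 2.
  rewrite mulr_sumr; apply: eq_bigr => l _.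
  by rewrite !mxE /= mulr0 addr0 exprMn.
have v_ge0 : 0 <= v by rewrite sumr_ge0 // => l _; exact: sqr_ge0.
rewrite paddr_eq0 ?sqr_ge0 // sqrf_eq0 vE mulf_eq0 sqrf_eq0.
apply/negP => /andP[]; rewrite !mxE !eqxx mulr1 => /eqP real0.
have sE := pnorm_sqr s; have pE := pnorm_sqr p.
case/orP => /eqP z.
  have p0s0 : s 0 0 = p 0 0 by move: z; rewrite /al; lra.
  apply: sp; apply: pclass_eq => //.
  by move: real0; rewrite z mul0r add0r /be sE pE p0s0; lra.
have ss : 0 <= \sum_(l < n) s 0 (lift ord0 l) ^+ 2.
  by rewrite sumr_ge0 // => l _; exact: sqr_ge0.
have : (p 0 0 - s 0 0) ^+ 2 + \sum_(l < n) s 0 (lift ord0 l) ^+ 2 == 0.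
  by rewrite -[X in _ == X]real0 /al /be sE pE z; apply/eqP; ring.
rewrite paddr_eq0 ?sqr_ge0 // sqrf_eq0 subr_eq0 => /andP[/eqP p0s0 /eqP s0].
by apply: sp; apply: pclass_eq; rewrite ?p0s0 ?z ?s0.
Qed.

End CliffordParavectors.

(** * Clifford multiplications and paravector operators *)

Section Operators.
Variables (R : realType) (n : nat) (V : normedModType R).
Local Notation cl := (@clop R n V).

Lemma clopD a b : cl (a + b) = cl a + cl b.
Proof. by apply: bopP => v; exact: lactDl. Qed.

Lemma clopM a b : cl (a * b) = cl a * cl b.
Proof. by apply: bopP => v; rewrite /= lactA. Qed.

Lemma clop1 : cl 1 = 1.
Proof. by apply: bopP => v; exact: lact1. Qed.

Lemma clopZ k a : cl (k *: a) = k *: cl a.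
Proof. by apply: bopP => v; apply: cprodZl; exact: bilin_scale. Qed.

Lemma bop_scalerAl k (f g : bop n V) : k *: (f * g) = (k *: f) * g.
Proof. exact: bopP. Qed.

Lemma bop_scalerAr k (f g : bop n V) : k *: (f * g) = f * (k *: g).
Proof. by apply: bopP => v; rewrite /= bopZ. Qed.

Lemma clopN a : cl (- a) = - cl a.
Proof. by rewrite -scaleN1r clopZ scaleN1r. Qed.

Lemma clop_real k : cl k%:A = k *: (1 : bop n V).
Proof. by rewrite clopZ clop1. Qed.

Lemma comm_clop_real k (f : bop n V) : GRing.comm (cl k%:A) f.
Proof. by rewrite /GRing.comm clop_real -bop_scalerAl -bop_scalerAr mul1r mulr1. Qed.

Variable T : bc01 n V.
Local Notation a := (bc_bar T).
Local Notation t := (bc_lift T).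

Lemma comm_clop_lift c l : GRing.comm (cl c) (t l).
Proof.
apply: bopP => v; apply/ffunP => C; rewrite /= /lact /lift_fun !ffunE linear_sum.
apply: eq_bigr => A _; rewrite linear_sum; apply: eq_bigr => B _.
by rewrite !linearZ /= ffunE !scalerA mulrC.
Qed.

Lemma comm_lift l m : GRing.comm (t l) (t m).
Proof. by apply: bopP => v; apply/ffunP => A; rewrite /= !ffunE bc_comm. Qed.

(** The square of the vector part of T is minus the sum of the T_l^2, free of
    Clifford units. *)
Lemma comm_clop_vec_sqr c : GRing.comm (cl c) (bc_vec T ^+ 2).
Proof.
rewrite /bc_vec sqr_sum_anticomm ?index_enum_uniq //.
  apply: commr_sum => l _; rewrite exprMn_comm; last exact: comm_clop_lift.
  rewrite -[cl _ ^+ 2]clopM -expr2 clgen_sqr -scaleN1r.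
  apply: commrM; last by apply: commrX; exact: comm_clop_lift.
  exact/commr_sym/comm_clop_real.
move=> i j ij.
have E k l : cl (clgen R k) * t (lift ord0 k) * (cl (clgen R l) * t (lift ord0 l))
   = cl (clgen R k * clgen R l) * (t (lift ord0 k) * t (lift ord0 l)).
  by rewrite clopM -!mulrA [t _ * (cl _ * _)]mulrA -comm_clop_lift !mulrA.
rewrite !E [t _ * t (lift ord0 i)]comm_lift -mulrDl -clopD clgen_anticomm //.
by rewrite -(scale0r 1) clop_real scale0r mul0r.
Qed.

Lemma bc_opD_bar : bc_op T + a = t ord0 *+ 2.
Proof. by rewrite /bc_op /bc_bar addrACA subrr addr0. Qed.

Lemma comm_lift0_vec : GRing.comm (t ord0) (bc_vec T).
Proof.
apply: commr_sum => l _; apply: commrM; last exact: comm_lift.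
exact/commr_sym/comm_clop_lift.
Qed.

Lemma bc_opM_bar : bc_op T * a = t ord0 ^+ 2 - bc_vec T ^+ 2.
Proof.
by rewrite /bc_op /bc_bar mulrDl !mulrBr -comm_lift0_vec addrA subrK.
Qed.

Lemma bc_barM_op : a * bc_op T = bc_op T * a.
Proof.
by rewrite bc_opM_bar /bc_op /bc_bar mulrBl !mulrDr comm_lift0_vec addrKA.
Qed.

Lemma comm_clop_opD_bar c : GRing.comm (cl c) (bc_op T + a).
Proof. by rewrite bc_opD_bar; apply/commrMn/comm_clop_lift. Qed.

Lemma comm_clop_opM_bar c : GRing.comm (cl c) (bc_op T * a).
Proof.
rewrite bc_opM_bar; apply: commrB; last exact: comm_clop_vec_sqr.
by apply: commrX; exact: comm_clop_lift.
Qed.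

Lemma comm_parop_Qs s : rhoF T s -> GRing.comm (parop V s) (Qs T s).
Proof.
move=> rs; apply: commr_inverse => //; apply: commrD.
  apply: commrB; first by rewrite expr2 clopM; exact: commrM.
  by apply: commrM => //; exact: comm_clop_opD_bar.
exact: comm_clop_opM_bar.
Qed.

(** * The resolvent equations *)

(** Pulling Q_s(T) out to the left leaves S (S - a) - (S - a) T, which is the
    quadratic operator that Q_s(T) inverts. *)
Lemma SR_equation s : rhoF T s -> parop V s * SR T s - SR T s * bc_op T = 1.
Proof.
move=> rs; have [QP _] := inverseP rs.
rewrite -QP /SR mulrA comm_parop_Qs // -!mulrA -mulrBr; congr (_ * _).
rewrite mulrBr mulrBl bc_barM_op /Qpoly expr2 clopM -/(parop V s).
rewrite [_ * (bc_op T + a)]mulrDr opprB [- (_ + _)]opprD !addrA [LHS]addrAC.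
by congr (_ + _); rewrite addrAC.
Qed.

Lemma SL_equation s : rhoF T s -> SL T s * parop V s - bc_op T * SL T s = 1.
Proof.
move=> rs; have [_ PQ] := inverseP rs.
rewrite -PQ /SL -mulrA -comm_parop_Qs // !mulrA -mulrBl; congr (_ * _).
rewrite mulrBr mulrBl /Qpoly expr2 clopM -/(parop V s) comm_clop_opD_bar.
rewrite [(bc_op T + a) * _]mulrDl opprB [- (_ + _)]opprD !addrA [LHS]addrAC.
by congr (_ + _); rewrite addrAC.
Qed.

End Operators.

Theorem lemma5p1 (R : realType) (V : completeNormedModType R) (n : nat)
    (T : bc01 n V) (p s : 'rV[R]_n.+1) :
  odd n -> (3 < n)%N ->
  rhoF T p -> rhoF T s -> ~ pclass p s ->
  let h := (n.-1)./2 in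
  FR T s * SL T p + SR T s * FL T p
  + gamma R n *:
      (\sum_(0 <= i < h - 1) Qs T s ^+ (h - i - 1) * SR T s * SL T p * Qs T p ^+ (i + 1)
       + \sum_(0 <= i < h) Qs T s ^+ (h - i) * Qs T p ^+ (i + 1))
  = ((FR T s - FL T p) * parop V p - parop V (pconj s) * (FR T s - FL T p))
    * clop V (inverse (parav p ^+ 2 - (2 * s 0 0) *: parav p + (pnorm s ^+ 2)%:A)).
Proof.
move=> odd_n n_gt3 rp rs ps h.
have n1h : (n.+1)./2 = h.+1 by rewrite /h; lia.
have h_gt1 : (1 < h)%N by rewrite /h; lia.
set S := parop V s; set P := parop V p; set g := gamma R n.
set X := SR T s; set Y := SL T p; set U := Qs T s; set W := Qs T p.
have FRE : FR T s = g *: (U ^+ h * X).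
  by rewrite /FR n1h exprSr -mulrA.
have FLE : FL T p = g *: (Y * W ^+ h).
  by rewrite /FL n1h exprS mulrA.
pose L := \sum_(0 <= j < h.+1) U ^+ (h - j) * (X * Y) * W ^+ j
          + \sum_(0 <= i < h) U ^+ (h - i) * W ^+ i.+1.
(* The two products outside the bracket are the terms j = 0 and j = h of the
   first sum of L. *)
have -> : FR T s * Y + X * FL T p + g *:
      (\sum_(0 <= i < h - 1) U ^+ (h - i - 1) * X * Y * W ^+ (i + 1)
       + \sum_(0 <= i < h) U ^+ (h - i) * W ^+ (i + 1)) = g *: L.
  rewrite FRE FLE -bop_scalerAl -bop_scalerAr -!scalerDr /L; congr (_ *: _).
  under [in LHS]eq_bigr do rewrite addn1 -subnDA addn1 -[_ * X * Y]mulrA.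
  under [X in _ + (_ + X) = _]eq_bigr do rewrite addn1.
  rewrite addrA; congr (_ + _).
  have hE : h = (h - 1).+1 by rewrite subn1 prednK // ltnW.
  rewrite big_nat_recl // [in RHS]hE big_nat_recr //= -hE subn0 subnn !expr0.
  by rewrite mul1r mulr1 !mulrA addrAC addrA.
set q := parav p ^+ 2 - _ + _.
have [iq_q q_iq] : inverse q * q = 1 /\ q * inverse q = 1.
  by apply/inverseP/invertible_class_poly => //; exact: leq_trans n_gt3.
suff LE : (FR T s - FL T p) * P - parop V (pconj s) * (FR T s - FL T p)
          = (g *: L) * clop V q.
  by rewrite LE -mulrA -clopM q_iq clop1 mulr1.
have tL : sylvester S P (g *: L) = FR T s - FL T p.
  rewrite FRE FLE -scalerBr -(sylvester_Fresolvent (a := bc_bar T) (T := bc_op T)).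
  - by rewrite /sylvester -bop_scalerAl -bop_scalerAr -scalerBr.
  - exact: comm_parop_Qs.
  - exact: comm_parop_Qs.
  - exact: SR_equation.
  - exact: SL_equation.
have ssE : S + parop V (pconj s) = clop V (2 * s 0 0)%:A.
  by rewrite -clopD paravD_pconj.
have snE : parop V (pconj s) * S = clop V (pnorm s ^+ 2)%:A.
  by rewrite -clopM -{2}(pconjK s) parav_mul_pconj pnorm_pconj.
rewrite -tL sylvester_pair ?ssE ?snE; try exact: comm_clop_real.
congr (_ * _); rewrite /q !clopD; congr (_ + _ + _).
  by rewrite expr2 clopM.
by rewrite clopN -[_ *: parav p]mulr_algl clopM.
Qed.
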